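(* Let $h(n)$, $n\ge 1$, be the integers defined by $\sum_{n=1}^{\infty} h(n)q^n=\sum_{n=1}^{\infty}\frac{(-1)^{n+1}q^{n(n+1)/2}}{1-q^n}$. Then: (1) For all sufficiently large $X$, $$\frac{\sqrt{X}}{\log X}\ll\#\{1\le n\le X : h(n)=1\}<\left(1+\frac{1}{\sqrt{2}}\right)\sqrt{X}.$$ (2) If $n=2^k$, where $k\ge 1$ is an integer, then $h(n)=1$. (3) If $n=p^{2k}$, where $p$ is an odd prime and $k$ is a positive integer, then $h(n)=1$. (4) If $n=p_1^2p_2^2$, where $p_1$ and $p_2$ are odd primes with $p_2>\sqrt{2}\,p_1$, then $h(n)=1$.
   Context: The identity defining $h(n)$ is an identity of formal power series in $q$, with each $\frac{1}{1-q^n}$ expanded as $\sum_{m\ge 0}q^{nm}$. In the counting function, $n$ ranges over positive integers. The notation $f(X)\ll g(X)$ means that there is an absolute constant $c>0$ such that $c\,f(X)\le g(X)$ for all sufficiently large $X$. *)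

(* Defs.v *)
From mathcomp Require Import all_boot all_order all_algebra.
From mathcomp Require Import all_classical all_reals all_analysis.
Set Implicit Arguments.
Unset Strict Implicit.
Unset Printing Implicit Defensive.
Import Order.TTheory GRing.Theory Num.Theory.
Local Open Scope ring_scope.

(* Z[[q]], with [f k] the coefficient of q^k. *)
Definition fps := nat -> int.

Definition fps_Xn (n : nat) : fps := fun k => (k == n)%:R.

Definition fps_scale (a : int) (f : fps) : fps := fun k => a * f k.

Definition fps_mul (f g : fps) : fps :=
  fun k => \sum_(i < k.+1) f i * g (k - i)%N.

(* S = \sum_(n >= a) F n in Z[[q]]: each coefficient of the partial sums is
   eventually constant, equal to that of S. *)
Definition fps_has_sum (a : nat) (F : nat -> fps) (S : fps) : Prop :=
  forall k, exists N0 : nat, forall N : nat, (N0 <= N)%N ->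
    \sum_(a <= n < N) F n k = S k.

(* 1 / (1 - q^n) for n > 0, see [fps_geomP]. *)
Definition fps_geom (n : nat) : fps := fun k => (n %| k)%:R.

Lemma fps_geomP (n : nat) : (0 < n)%N ->
  fps_has_sum 0 (fun m => fps_Xn (n * m)) (fps_geom n).
Proof.
move=> n0 k; exists k.+1 => N kN; rewrite /fps_geom /fps_Xn big_mkord.
case: (boolP (n %| k)%N) => [/dvdnP[d kE]|ndvd].
  have dN : (d < N)%N by apply: leq_trans kN; rewrite ltnS kE leq_pmulr.
  rewrite (bigD1 (Ordinal dN)) //= kE mulnC eqxx big1 ?addr0// => i id.
  rewrite eqn_pmul2l // eq_sym; case: eqP => // di.
  by case/eqP: id; apply: val_inj.
rewrite big1 // => i _; case: eqP => // kE.
by rewrite kE dvdn_mulr in ndvd.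
Qed.

Definition h_term (n : nat) : fps :=
  fps_scale ((-1) ^+ n.+1) (fps_mul (fps_Xn (n * n.+1)./2) (fps_geom n)).

(* \sum_(n >= 1) h n q^n = \sum_(n >= 1) h_term n; h 0 is irrelevant. *)
Definition h_identity (h : nat -> int) : Prop :=
  exists S : fps,
    fps_has_sum 1 (fun n => fps_scale (h n) (fps_Xn n)) S /\
    fps_has_sum 1 h_term S.

Lemma h_identity_ex : exists h, h_identity h.
Proof.
have t0 n k : (k < n)%N -> h_term n k = 0.
  move=> kn; rewrite /h_term /fps_scale /fps_mul big1 ?mulr0// => i _.
  rewrite /fps_Xn; case: eqP => [iE|]; last by rewrite mul0r.
  have := ltn_ord i; rewrite iE ltnS => le_k.
  case: n kn iE le_k => // n kn _ le_k; exfalso.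
  have : (n.+1 <= (n.+1 * n.+2)./2)%N.
    by rewrite -{1}(doubleK n.+1) half_leq// -muln2 leq_mul2l.
  by rewrite leqNgt (leq_ltn_trans le_k kn).
pose S k := \sum_(1 <= n < k.+1) h_term n k.
exists S, (fun k => if k is 0 then 0 else S k); split=> k; exists k.+1 => N kN.
  rewrite /fps_scale /fps_Xn; case: k kN => [|k] kN.
    by rewrite big_nat big1 // => i /andP[i0 _]; rewrite (ltn_eqF i0) mulr0.
  rewrite (@big_cat_nat _ _ _ k.+1)//=; last exact: ltnW.
  rewrite big_nat big1 ?add0r; last first.
    by move=> i /andP[_ ik]; rewrite (gtn_eqF ik) mulr0.
  rewrite big_ltn// eqxx mulr1 big_nat big1 ?addr0// => i /andP[ki _].
  by rewrite (ltn_eqF ki) mulr0.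
have -> : (if k is 0 then 0 else S k) = S k.
  by case: k kN => // _; rewrite /S big_geq.
rewrite (@big_cat_nat _ _ _ k.+1)//= [X in _ + X]big_nat [X in _ + X]big1 ?addr0//.
by move=> i /andP[ki _]; exact: t0.
Qed.

(* #{1 <= n <= X : h n = 1} for a real X. *)
Definition count_h1 (R : realType) (h : nat -> int) (X : R) : nat :=
  size [seq n <- iota 1 (Num.truncn X) | h n == 1].

Definition vinogradov_ll (R : realType) (f g : R -> R) : Prop :=
  exists2 c : R, 0 < c & \forall X \near +oo%R, c * f X <= g X.

(* Main.v *)
Require Import Defs.
From mathcomp Require Import all_boot all_order all_algebra.
From mathcomp Require Import all_classical all_reals all_analysis.
From mathcomp Require Import zify lra.
Import Order.TTheory GRing.Theory Num.Theory.

(** The coefficient of q^k in the n-th term of the series is nonzero exactly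
    when k = n(n+1)/2 + n j with j >= 0, that is, when 2k = n e with e > n and
    e of parity opposite to n.  Write k = 2^a l with l odd and c = 2^(a+1), so
    that 2k = c l.  One of n, e is then an odd divisor d of l and the other is
    c l / d.  The odd n are the d | l with d^2 < c l and count +1; the even n
    are the c d with d | l and c d^2 < l and count -1.  As c d^2 = l is
    impossible by parity, the difference counts the central divisors of l:
        h(k) = #{d | l : l <= c d^2 and d^2 < c l}
    ([h_central_divisors]).

    The exact values follow by showing that sqrt l is the only divisor in this
    window.  For k = 2^a this is clear; for an odd square k the window is
    1/2 < d/e < 2 where d e = k, and in the two families considered distinct
    complementary divisors differ by a factor of at least 2
    ([h_odd_square_gap]).

    For the upper bound, the window is symmetric under d -> l/d, so a single
    central divisor is its own complement and l is a square
    ([square_of_h1]); hence k is s^2 or 2 s^2.  This gives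
    floor(sqrt X) + floor(sqrt(X/2)) candidates, and the inequality is strict
    because 72 = 2 * 6^2 is a candidate with h(72) = 3.

    For the lower bound, h(p^2) = 1 for every prime p <= sqrt X, and there are
    at least a constant times sqrt X / log X of these by Chebyshev's argument:
    each prime power in the factorization of 'C(2n, n) is at most 2n
    ([logn_central_bin]), whence 2^n <= 'C(2n, n) <= (2n)^pi(2n). *)

(** * Chebyshev's lower bound for the number of primes *)

Definition prime_pi (n : nat) : nat := count prime (iota 1 n).

Lemma central_bin_ge (n : nat) : 2 ^ n <= 'C(n.*2, n).
Proof.
elim: n => [|n IHn]; first by rewrite bin0.
have sym : 'C(n.*2.+1, n.+1) = 'C(n.*2.+1, n).
  by rewrite -bin_sub; [congr 'C(_, _); lia | lia].
rewrite doubleS binS sym addnn expnS mul2n leq_double (leq_trans IHn) //.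
by case: (n) => // m; rewrite binS leq_addr.
Qed.

(** By Legendre's formula the exponent of p is the sum over k >= 1 of
    floor(2n/p^k) - 2 floor(n/p^k); each summand is 0 or 1, and it vanishes
    once p^k > 2n. *)
Lemma logn_central_bin (p n : nat) : prime p -> 0 < n ->
  p ^ logn p 'C(n.*2, n) <= n.*2.
Proof.
move=> pp n0; have p1 := prime_gt1 pp.
apply: leq_trans (trunc_logP p1 _); last by rewrite double_gt0.
rewrite leq_exp2l //.
have fact2 : n.*2`! = 'C(n.*2, n) * (n`! * n`!).
  by rewrite -(@bin_fact n.*2 n) ?subnn -addnn ?addnK // leq_addr.
have logE : logn p n.*2`! = logn p 'C(n.*2, n) + (logn p n`!).*2.
  by rewrite fact2 !lognM ?muln_gt0 ?fact_gt0 ?bin_gt0 ?addnn // -addnn leq_addr.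
have logn2 : logn p n`! = \sum_(1 <= k < n.*2.+1) n %/ p ^ k.
  rewrite logn_fact // (@big_cat_nat _ _ _ n.+1 1 n.*2.+1) //=; last by lia.
  rewrite [X in _ + X]big_nat [X in _ + X]big1 ?addn0 // => k /andP[nk _].
  by rewrite divn_small // (leq_trans nk) // ltnW // ltn_expl.
have -> : logn p 'C(n.*2, n) = logn p n.*2`! - (logn p n`!).*2 by lia.
set L := trunc_log p n.*2.
(* A summand can be nonzero only when p^k <= 2n, that is, when k <= L. *)
have cntL : \sum_(1 <= k < n.*2.+1) (k <= L) <= L.
  rewrite -big_mkcond sum1_count -size_filter -[leqRHS](size_iota 1).
  apply: uniq_leq_size; first by rewrite filter_uniq // iota_uniq.
  by move=> k; rewrite mem_filter !mem_iota; lia.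
rewrite leq_subLR; apply: leq_trans (leq_add (leqnn _) cntL).
rewrite logn2 logn_fact // -(muln2 (\sum_(_ <= _ < _) _)) big_distrl -big_split /=.
apply: leq_sum => k _; have pk0 : 0 < p ^ k by rewrite expn_gt0 prime_gt0.
have -> : (k <= L) = (p ^ k <= n * 2).
  apply/idP/idP => [kL|]; last by rewrite muln2; apply: trunc_log_max.
  rewrite muln2 (leq_trans _ (trunc_logP p1 _)) ?double_gt0 //.
  by rewrite leq_exp2l.
rewrite -ltnS ltn_divLR // -muln2.
case: (leqP (p ^ k) (n * 2)) => [_|lt] /=.
  by have := ltn_ceil n pk0; nia.
by rewrite (leq_trans lt) // leq_pmull.
Qed.

(** Every prime factor of 'C(2n, n) divides (2n)!, hence is at most 2n, and it
    contributes a prime power of at most 2n to the product. *)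
Lemma central_bin_prime_pi (n : nat) : 0 < n -> 2 ^ n <= n.*2 ^ prime_pi n.*2.
Proof.
move=> n0; set C := 'C(n.*2, n); have C0 : 0 < C by rewrite bin_gt0 -addnn leq_addr.
apply: leq_trans (central_bin_ge n) _; rewrite -/C.
apply: (@leq_trans (n.*2 ^ size (primes C))).
  rewrite {1}(prod_prime_decomp C0) prime_decompE big_map.
  rewrite -[X in _ <= _ ^ X]sum1_size expn_sum big_seq [leqRHS]big_seq.
  apply: leq_prod => p; rewrite mem_primes expn1 => /and3P[pp _ _].
  exact: logn_central_bin.
rewrite leq_pexp2l ?double_gt0 // /prime_pi -size_filter.
apply: uniq_leq_size (primes_uniq _) _ => p.
rewrite mem_primes mem_filter mem_iota => /and3P[pp _ pC]; rewrite pp prime_gt0 //=.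
have : p %| n.*2`! by rewrite -(@bin_fact n.*2 n) ?dvdn_mulr // -addnn leq_addr.
rewrite add1n ltnS; elim: n.*2 => [|m IHm]; first by rewrite Euclid_dvd1.
rewrite factS Euclid_dvdM // => /orP[/dvdn_leq -> //|/IHm/leq_trans]; exact.
Qed.

Local Open Scope ring_scope.

(** * The coefficients h(k) as counts of central divisors *)

Lemma h_term_coef (n k : nat) : (0 < n)%N ->
  h_term n k = (-1) ^+ n.+1 *
    (((n * n.+1)./2 <= k) && (n %| k - (n * n.+1)./2))%N%:R.
Proof.
move=> n0; rewrite /h_term /fps_scale /fps_mul /fps_Xn /fps_geom; congr (_ * _).
case: leqP => [le|gt] /=.
  rewrite (bigD1 (Ordinal (le : _ < k.+1)%N)) //= eqxx mul1r big1 ?addr0 // => i id.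
  by case: eqP => [E|]; [case/eqP: id; apply: val_inj | rewrite mul0r].
rewrite big1 // => i _; case: eqP => [E|]; last by rewrite mul0r.
by have := ltn_ord i; rewrite E ltnS leqNgt gt.
Qed.

(** Doubling k = n(n+1)/2 + n j turns it into 2k = n e with e = n + 1 + 2j; the
    condition j >= 0 becomes n < e with n + e odd. *)
Lemma h_term_supp (n k : nat) : (0 < n)%N ->
  reflect (exists e, [/\ (n * e = 2 * k)%N, (n < e)%N & odd (n + e)])
          (((n * n.+1)./2 <= k) && (n %| k - (n * n.+1)./2))%N.
Proof.
move=> n0; have tri : (2 * (n * n.+1)./2 = n * n.+1)%N.
  by rewrite mul2n even_halfK // oddM oddS andbN.
apply: (iffP andP) => [[le /dvdnP[j jE]]|[e [E lt od]]].
  exists (n.+1 + 2 * j)%N; split; [nia | lia | lia].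
have [j jE] : exists j, e = (n.+1 + 2 * j)%N.
  by exists (e - n.+1)./2; lia.
have kE : k = ((n * n.+1)./2 + j * n)%N by rewrite jE in E; nia.
by rewrite kE leq_addr addKn dvdn_mull.
Qed.

(** The two factors n, e of 2k = c l have opposite parity, so the odd one is
    coprime to c and divides l, while the even one is a multiple of c.  The two
    membership alternatives are the cases n odd and n even; n < e amounts to
    n^2 < 2k. *)
Lemma h_term_suppE (a l n : nat) : odd l -> (0 < n)%N ->
  let k := (2 ^ a * l)%N in let c := (2 ^ a.+1)%N in
  (((n * n.+1)./2 <= k) && (n %| k - (n * n.+1)./2))%N =
  (n ^ 2 < c * l)%N &&
  ((n \in divisors l) || (n \in [seq c * d | d <- divisors l])%N).
Proof.
move=> odl n0 k c; have l0 : (0 < l)%N by case: (l) odl.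
have c0 : (0 < c)%N by rewrite expn_gt0.
have ce : ~~ odd c by rewrite oddX.
have kc : (2 * k = c * l)%N by rewrite mulnA -expnS.
apply/h_term_supp/idP => // [[e [E lt od]]|].
  rewrite kc in E; have -> /= : (n ^ 2 < c * l)%N by nia.
  have cop x : odd x -> coprime c x by move=> ox; rewrite coprimeXl // coprime2n.
  have [on|en] := boolP (odd n).
    by rewrite -dvdn_divisors // -(@Gauss_dvdr _ c) 1?coprime_sym ?cop // -E dvdn_mulr.
  have : (c %| n)%N by rewrite -(@Gauss_dvdl _ _ e) ?E ?dvdn_mulr // cop //; lia.
  case/dvdnP => d nE; apply/orP; right; apply/mapP; exists d; last by rewrite mulnC.
  by rewrite -dvdn_divisors //; apply/dvdnP; exists e; nia.
case/andP => lt /orP[|/mapP[d]]; rewrite -dvdn_divisors // => /dvdnP[x lE].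
  exists (c * x)%N; rewrite kc; split; [nia | nia | ].
  by rewrite lE oddM in odl; rewrite oddD oddM (negbTE ce); case/andP: odl => _ ->.
move=> nE; exists x; rewrite kc; split; [nia | nia | ].
by rewrite lE oddM in odl; rewrite nE oddD oddM (negbTE ce); case/andP: odl => ->.
Qed.

Lemma big_nat_mem_seq (V : nmodType) (s : seq nat) (N : nat) (F : nat -> V) :
  uniq s -> {subset s <= index_iota 1 N} ->
  \sum_(1 <= n < N | n \in s) F n = \sum_(n <- s) F n.
Proof.
move=> us sub; rewrite -big_filter; apply: perm_big; apply: uniq_perm => //.
  by rewrite filter_uniq // iota_uniq.
by move=> x; rewrite mem_filter; case xs: (x \in s); rewrite // sub.
Qed.

(** With d e = l, this is the window 1/c <= d/e < c on the ratio of
    complementary divisors. *)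
Definition central (c l d : nat) : bool := ((l <= c * d ^ 2) && (d ^ 2 < c * l))%N.

(** The even terms n = c d with d | l cancel the odd terms n = d exactly when
    c d^2 < l; the divisors left over are the central ones. *)
Lemma h_central_divisors (h : nat -> int) (a l : nat) : h_identity h -> odd l ->
  h (2 ^ a * l)%N = (count (central (2 ^ a.+1) l) (divisors l))%:Z.
Proof.
case=> S [Sh St] odl; have l0 : (0 < l)%N by case: (l) odl.
set k := (2 ^ a * l)%N; set c := (2 ^ a.+1)%N.
have c1 : (1 < c)%N by rewrite (ltn_exp2l 0).
have ce : ~~ odd c by rewrite oddX.
have k0 : (0 < k)%N by rewrite muln_gt0 expn_gt0.
have [N1 HN1] := Sh k; have [N2 HN2] := St k.
(* An upper summation limit that covers every n with a nonzero term and at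
   which both partial sums have reached the coefficient. *)
pose N := maxn (c * l).+1 (maxn k.+1 (maxn N1 N2)).
have {HN1} := HN1 N _; have {HN2} := HN2 N _.
rewrite /N !leq_max !leqnn !orbT -/N => /(_ isT) <- /(_ isT).
have kN : k \in index_iota 1 N by rewrite mem_index_iota k0 /N; lia.
rewrite (bigD1_seq k kN (iota_uniq _ _)) /=.
rewrite {1}/fps_scale /fps_Xn eqxx mulr1 big1 ?addr0; last first.
  by move=> i ik; rewrite /fps_scale /fps_Xn eq_sym (negbTE ik) mulr0.
move=> ->; set s := divisors l; set s' := [seq c * d | d <- s]%N.
have odds n : n \in s -> odd n.
  by rewrite -dvdn_divisors // => /dvdn_odd; apply.
have evens n : n \in s' -> ~~ odd n.
  by case/mapP=> d _ ->; rewrite oddM (negbTE ce).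
have sub : {subset s <= index_iota 1 N}.
  move=> d; rewrite -dvdn_divisors // mem_index_iota => dl.
  by rewrite (dvdn_gt0 l0 dl) /N; have := dvdn_leq l0 dl; nia.
have sub' : {subset s' <= index_iota 1 N}.
  move=> n /mapP[d]; rewrite -dvdn_divisors // mem_index_iota => dl ->.
  by have := dvdn_gt0 l0 dl; have := dvdn_leq l0 dl; rewrite /N; nia.
transitivity (\sum_(1 <= n < N | n \in s) (n ^ 2 < c * l)%N%:Z
            - \sum_(1 <= n < N | n \in s') (n ^ 2 < c * l)%N%:Z).
  rewrite [X in X - _]big_mkcond [X in _ - X]big_mkcond -sumrB.
  rewrite !big_nat; apply: eq_bigr => n /andP[n0 _].
  rewrite h_term_coef // h_term_suppE // -/c -/s -/s' -signr_odd /=.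
  have := @odds n; have := @evens n.
  case: (n \in s') => [/(_ isT) en|_]; case: (n \in s) => [/(_ isT) on|_].
  - by rewrite on in en.
  - by rewrite en andbT expr1 mulN1r sub0r natz.
  - by rewrite on andbT expr0 mul1r subr0 natz.
  - by rewrite andbF mulr0 subr0.
rewrite !big_nat_mem_seq ?divisors_uniq //; last first.
  rewrite map_inj_uniq ?divisors_uniq // => x y /eqP.
  by rewrite eqn_pmul2l ?(ltnW c1) // => /eqP.
rewrite big_map -sumrB -sum1_count (big_morph Posz PoszD (erefl _)).
rewrite [RHS]big_mkcond big_seq [RHS]big_seq; apply: eq_bigr => d; rewrite -dvdn_divisors // => dl.
rewrite /central.
have ne : (c * d ^ 2 != l)%N.
  by apply: contraTneq odl => <-; rewrite oddM (negbTE ce).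
have d0 := dvdn_gt0 l0 dl.
have -> : ((c * d) ^ 2 < c * l)%N = (c * d ^ 2 < l)%N.
  by rewrite expnMn -mulnn -mulnA ltn_pmul2l // ltnW.
have lt2 : (c * d ^ 2 < l)%N -> (d ^ 2 < c * l)%N by nia.
case: (leqP l (c * d ^ 2)) => [_|/lt2 ->] //=.
by rewrite subr0; case: ltnP.
Qed.

(** * Numbers with a single central divisor *)

Lemma h1_of_central (h : nat -> int) (a m : nat) : h_identity h -> odd m ->
  (forall d, (d %| m ^ 2)%N -> central (2 ^ a.+1) (m ^ 2) d -> d = m) ->
  h (2 ^ a * m ^ 2)%N = 1.
Proof.
move=> hh om uni; rewrite h_central_divisors // ?oddX ?om //.
have m20 : (0 < m ^ 2)%N by rewrite expn_gt0; case: (m) om.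
have c1 : (1 < 2 ^ a.+1)%N by rewrite (ltn_exp2l 0).
rewrite (@eq_in_count _ _ (pred1 m)); last first.
  move=> d; rewrite -dvdn_divisors // => dm; apply/idP/eqP => [/uni->//|->].
  by rewrite /central leq_pmull ?ltn_Pmull // ltnW.
by rewrite count_uniq_mem ?divisors_uniq // -dvdn_divisors // dvdn_exp.
Qed.

(** If d is central then so is e = l/d, the left boundary of the window being
    excluded by the parity of c; when d is the only central divisor, e = d. *)
Lemma square_of_h1 (h : nat -> int) (a l : nat) : h_identity h -> odd l ->
  h (2 ^ a * l)%N = 1 -> exists m, l = (m ^ 2)%N.
Proof.
move=> hh odl; rewrite h_central_divisors // => -[] /eqP.
have l0 : (0 < l)%N by case: (l) odl.
set c := (2 ^ a.+1)%N => /eqP cnt.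
have ce : ~~ odd c by rewrite oddX.
have /hasP[d] : has (central c l) (divisors l) by rewrite has_count cnt.
rewrite -dvdn_divisors // => dl cd; have /dvdnP[e lE] := dl.
have el : (e %| l)%N by rewrite lE dvdn_mulr.
have ce' : central c l e.
  have d0 := dvdn_gt0 l0 dl; have e0 := dvdn_gt0 l0 el.
  have ne : (c * d != e)%N.
    by apply: contraTneq odl => E; rewrite lE -E !oddM (negbTE ce).
  case/andP: cd => c1 c2; have {}c1 : (e < c * d)%N.
    by rewrite ltn_neqAle eq_sym ne; nia.
  by apply/andP; split; nia.
case: (eqVneq d e) => [de|de]; first by exists e; rewrite lE de mulnn.
have : (size [:: d; e] <= size [seq x <- divisors l | central c l x])%N.
  apply: uniq_leq_size => [|x]; first by rewrite /= inE de.
  by rewrite !inE mem_filter => /orP[] /eqP ->; rewrite -dvdn_divisors // ?cd ?ce' ?dl.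
by rewrite size_filter cnt.
Qed.

Lemma h_pow2 (h : nat -> int) (k : nat) : h_identity h -> h (2 ^ k)%N = 1.
Proof.
move=> hh; rewrite -(muln1 (2 ^ k)%N); apply: (@h1_of_central h k 1) => // d.
by rewrite dvdn1 => /eqP.
Qed.

(** The window for a = 0 requires the ratio of complementary divisors to lie
    strictly between 1/2 and 2, so a factor 2 between distinct ones leaves only
    the square root. *)
Lemma h_odd_square_gap (h : nat -> int) (m : nat) : h_identity h -> odd m ->
  (forall d e, (d * e = m ^ 2)%N -> (d < e)%N -> (2 * d <= e)%N) ->
  h (m ^ 2)%N = 1.
Proof.
move=> hh om gap; rewrite -(mul1n (m ^ 2)%N); apply: (@h1_of_central h 0 m) => // d.
have m0 : (0 < m)%N by case: (m) om.
case/dvdnP => e E /andP[]; rewrite expn1 E => c1 c2.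
have d0 : (0 < d)%N by nia.
have e0 : (0 < e)%N by nia.
have od : odd d by have : odd (m ^ 2)%N by [rewrite oddX om]; rewrite E oddM => /andP[].
have [lt|gt|eq] := ltngtP d e.
- by have := gap d e; rewrite E mulnC => /(_ erefl lt); nia.
- have := gap e d; rewrite E => /(_ erefl gt) le.
  have : (2 * e != d)%N by apply: contraTneq od => <-; rewrite oddM.
  by nia.
- by rewrite eq in E *; nia.
Qed.

Lemma h_prime_pow (h : nat -> int) (p k : nat) : h_identity h -> prime p -> odd p ->
  h (p ^ (2 * k))%N = 1.
Proof.
move=> hh pp op; rewrite mulnC expnM; apply: h_odd_square_gap => //; first by rewrite oddX op orbT.
move=> d e; rewrite -expnM => E lt.
have p2 : (2 < p)%N by apply: odd_prime_gt2.
have /(dvdn_pfactor _ _ pp)[i _ dE] : (d %| p ^ (k * 2))%N by rewrite -E dvdn_mulr.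
have /(dvdn_pfactor _ _ pp)[j _ eE] : (e %| p ^ (k * 2))%N by rewrite -E dvdn_mull.
move: lt; rewrite dE eE ltn_exp2l ?(ltnW p2) // => ij.
apply: (@leq_trans (p ^ i.+1)%N); last by rewrite leq_exp2l // ltnW.
by rewrite expnS leq_mul // ltnW.
Qed.

(** Each of the k factors p divides d or e; cancelling them one at a time leaves
    a factorization of x.  Applied to one prime after another, this enumerates
    the factorizations of a product of prime powers. *)
Lemma prime_pow_factor_split (p k x d e : nat) : prime p -> (d * e = p ^ k * x)%N ->
  exists i d' e', [/\ (i <= k)%N, d = (p ^ i * d')%N, e = (p ^ (k - i) * e')%N
                    & (d' * e' = x)%N].
Proof.
move=> pp; elim: k d e => [|k IHk] d e E.
  by exists 0%N, d, e; rewrite E !mul1n.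
have p0 := prime_gt0 pp.
have : (p %| d * e)%N by rewrite E expnS -mulnA dvdn_mulr.
rewrite Euclid_dvdM // => /orP[] /dvdnP[y yE].
  have [|i [d' [e' [ik yE' eE xE]]]] := IHk y e.
    by apply/eqP; rewrite -(eqn_pmul2l p0) mulnA (mulnC p y) -yE E expnS mulnA.
  exists i.+1, d', e'; split => //.
  by rewrite yE yE' expnS mulnC mulnA.
have [|i [d' [e' [ik dE yE' xE]]]] := IHk d y.
  by apply/eqP; rewrite -(eqn_pmul2l p0) mulnCA (mulnC p y) -yE E expnS mulnA.
exists i, d', e'; split; rewrite ?(leqW ik) //.
by rewrite yE yE' subSn // expnS mulnC mulnA.
Qed.

(** Of the nine factorizations d e = p^2 q^2, those with d < e have ratio e/d
    among q^2, p^2, (p q)^2 and q^2/p^2.  The first three are at least 9, and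
    the last exceeds 2 by hypothesis. *)
Lemma h_p2q2 (h : nat -> int) (p q : nat) : h_identity h ->
  prime p -> odd p -> prime q -> odd q -> (2 * p ^ 2 < q ^ 2)%N ->
  h (p ^ 2 * q ^ 2)%N = 1.
Proof.
move=> hh pp op qp oq lt; rewrite -expnMn; apply: h_odd_square_gap; rewrite ?oddM ?op //.
move=> d e E de.
have p2 : (2 < p)%N by apply: odd_prime_gt2.
have q2 : (2 < q)%N by apply: odd_prime_gt2.
rewrite expnMn in E.
have [i [d1 [e1 [i2 dE eE E1]]]] := prime_pow_factor_split _ _ _ _ _ pp E.
(* The factor 1 is the leftover once both primes are removed. *)
rewrite -(muln1 (q ^ 2)%N) in E1.
have [j [d2 [e2 [j2 d1E e1E /eqP]]]] := prime_pow_factor_split _ _ _ _ _ qp E1.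
rewrite muln_eq1 => /andP[/eqP d2E /eqP e2E]; subst d2 e2 d1 e1 d e.
move: de lt; case: i i2 {E} => [|[|[|//]]] _; case: j j2 {E1} => [|[|[|//]]] _;
  rewrite !muln1 ?expn0 ?subn0 ?subnn ?subSS ?mul1n ?muln1 ?expn1; nia.
Qed.

(** * Counting the n <= X with h(n) = 1 *)

Lemma mem_count_h1 (R : realType) (h : nat -> int) (X : R) (n : nat) :
  (n \in [seq n <- iota 1 (Num.truncn X) | h n == 1]) =
  [&& h n == 1, (0 < n)%N & n%:R <= X].
Proof.
rewrite mem_filter mem_iota add1n ltnS; case: n => [|n] //=.
by rewrite truncn_gt_nat.
Qed.

(** The squares of all primes are counted: for p = 2 because 4 is a power of 2,
    for odd p as prime powers with an even exponent. *)
Lemma prime_pi_le_count (R : realType) (h : nat -> int) (X : R) :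
  h_identity h -> 0 <= X ->
  (prime_pi (Num.truncn (Num.sqrt X)) <= count_h1 h X)%N.
Proof.
move=> hh X0; rewrite /prime_pi -size_filter -(size_map (fun p => p ^ 2)%N).
apply: uniq_leq_size.
  rewrite map_inj_uniq ?filter_uniq ?iota_uniq // => p q.
  by move/eqP; rewrite eqn_exp2r // => /eqP.
move=> _ /mapP[p + ->]; rewrite mem_filter mem_iota add1n ltnS mem_count_h1.
case/and3P => pp p0; rewrite truncn_ge_nat ?sqrtr_ge0 // => pX.
apply/and3P; split; last 1 first.
- by rewrite natrX -[leRHS]sqr_sqrtr // lerXn2r ?nnegrE ?sqrtr_ge0 ?ler0n.
- have [->|op] := even_prime pp; first by rewrite h_pow2.
  by rewrite (h_prime_pow h p 1 hh pp op).
- by rewrite expn_gt0 p0.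
Qed.

(** Rounding N down to an even number only decreases the number of primes. *)
Lemma prime_pi_ln (R : realType) (N : nat) : (1 < N)%N ->
  (N./2)%:R * ln 2 <= (prime_pi N)%:R * ln N%:R :> R.
Proof.
move=> N1; have n0 : (0 < N./2)%N by lia.
have nN : (N./2.*2 <= N)%N by lia.
have piN : (prime_pi N./2.*2 <= prime_pi N)%N.
  rewrite /prime_pi.
  have -> : iota 1 N = iota 1 N./2.*2 ++ iota (1 + N./2.*2) (N - N./2.*2).
    by rewrite -iotaD subnKC.
  by rewrite count_cat leq_addr.
have le : (2 ^ N./2 <= N ^ prime_pi N)%N.
  apply: leq_trans (central_bin_prime_pi _ n0) _.
  apply: (@leq_trans (N ^ prime_pi N./2.*2)%N); last first.
    by rewrite leq_pexp2l // ltnW.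
  by case: (prime_pi N./2.*2) => // e; rewrite leq_exp2r.
rewrite !mulr_natl -!lnXn ?ltr0n ?(ltnW N1) // ler_ln ?posrE ?exprn_gt0 ?ltr0n ?(ltnW N1) //.
by rewrite -!natrX ler_nat.
Qed.

(** With N = floor(sqrt X), Chebyshev's bound gives pi(N) ln N >= floor(N/2) ln 2;
    once sqrt X >= 4, floor(N/2) >= sqrt X / 4. *)
Lemma count_lower (R : realType) (h : nat -> int) (X : R) : h_identity h ->
  16 <= X -> ln 2 / 4 * (Num.sqrt X / ln X) <= (count_h1 h X)%:R.
Proof.
move=> hh X16; have X0 : 0 <= X by lra.
have l2 : 0 < ln 2 :> R by apply: ln_gt0; lra.
have lX : 0 < ln X by apply: ln_gt0; lra.
have s4 : 4 <= Num.sqrt X.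
  by rewrite -(@ler_sqr _ 4) ?nnegrE ?sqrtr_ge0 // sqr_sqrtr //; lra.
set N := Num.truncn (Num.sqrt X).
have /andP[N1 N2] : N%:R <= Num.sqrt X < N.+1%:R by apply: truncn_itv; lra.
have N4 : (4 <= N)%N by rewrite truncn_ge_nat //; lra.
have half : Num.sqrt X / 4 <= (N./2)%:R.
  have : (N.+1 <= 2 * (N./2).+1)%N by lia.
  rewrite -(ler_nat R) natrM -[(N./2).+1%:R]natr1; lra.
have lN : ln N%:R <= ln X.
  rewrite ler_ln ?posrE ?ltr0n; [|lia|lra].
  by have := sqr_sqrtr X0; rewrite expr2; nra.
rewrite mulrA ler_pdivrMr //.
apply: (@le_trans _ _ ((N./2)%:R * ln 2)); first nra.
apply: le_trans (prime_pi_ln R _ _) _; first lia.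
apply: ler_pM; rewrite ?ler0n ?ler_nat ?prime_pi_le_count //.
by apply: ln_ge0; rewrite ler1n; lia.
Qed.

(** The odd part of n is a square m^2, so n = 2^a m^2, and the parity of a
    decides between the two forms; s = 2^(a/2) m. *)
Lemma h1_sq_or_2sq (h : nat -> int) (n : nat) : h_identity h -> (0 < n)%N -> h n = 1 ->
  exists2 s, (0 < s)%N & n = (s ^ 2)%N \/ n = (2 * s ^ 2)%N.
Proof.
move=> hh n0 h1; have [l cop nE] := pfactor_coprime (isT : prime 2) n0.
rewrite coprime2n in cop; rewrite mulnC in nE.
have [m lE] := square_of_h1 _ (logn 2 n) _ hh cop (etrans (congr1 h (esym nE)) h1).
have m0 : (0 < m)%N by case: (m) lE cop => // ->.
set a := logn 2 n in nE; exists (2 ^ a./2 * m)%N; first by rewrite muln_gt0 expn_gt0.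
rewrite nE lE expnMn -expnM muln2 -{1 3}(odd_double_half a).
by case: (odd a); [right; rewrite add1n expnS mulnA | left].
Qed.

(** Here l = 9 and c = 16: all of 1, 3 and 9 are central. *)
Lemma h_72 (h : nat -> int) : h_identity h -> h 72 = 3.
Proof. by move=> hh; rewrite (h_central_divisors _ 3 9 hh). Qed.

(** Together with 72, the counted numbers inject into the squares and doubled
    squares up to X; the extra element 72 makes the bound strict. *)
Lemma count_upper (R : realType) (h : nat -> int) (X : R) : h_identity h ->
  72 <= X -> (count_h1 h X)%:R < (1 + 1 / Num.sqrt 2) * Num.sqrt X.
Proof.
move=> hh X72; have X0 : 0 <= X by lra.
set A := Num.truncn (Num.sqrt X); set B := Num.truncn (Num.sqrt (X / 2)).
have sqle (s : nat) (Y : R) : 0 <= Y -> (s ^ 2)%:R <= Y -> (s <= Num.truncn (Num.sqrt Y))%N.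
  move=> Y0 sY; rewrite truncn_ge_nat ?sqrtr_ge0 //.
  by rewrite -ler_sqr ?nnegrE ?sqrtr_ge0 // sqr_sqrtr // -natrX.
have cnt : ((count_h1 h X).+1 <= A + B)%N.
  rewrite -(size_iota 1 A) -(size_iota 1 B).
  rewrite -(size_map (fun s => s ^ 2)%N) -(size_map (fun s => 2 * s ^ 2)%N (iota _ B)).
  rewrite -size_cat; set t := _ ++ _.
  apply: (@uniq_leq_size _ (72%N :: [seq n <- iota 1 (Num.truncn X) | h n == 1]) t).
    by rewrite /= filter_uniq ?iota_uniq // andbT mem_count_h1 h_72.
  have in2 (s : nat) : (0 < s)%N -> (2 * s ^ 2)%:R <= X -> (2 * s ^ 2)%N \in t.
    move=> s0 sX; rewrite mem_cat; apply/orP; right; apply/mapP; exists s => //.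
    rewrite mem_iota s0 add1n ltnS sqle //; first lra.
    by move: sX; rewrite natrM; lra.
  move=> n; rewrite inE mem_count_h1 => /orP[/eqP ->|/and3P[/eqP h1 n0 nX]].
    by apply: (in2 6%N) => //; lra.
  have [s s0 [nE|nE]] := h1_sq_or_2sq _ _ hh n0 h1; rewrite nE in nX *; last exact: in2.
  rewrite mem_cat; apply/orP; left; apply/mapP; exists s => //.
  by rewrite mem_iota s0 add1n ltnS sqle.
have Ale : A%:R <= Num.sqrt X by rewrite truncn_le sqrtr_ge0.
have Ble : B%:R <= Num.sqrt (X / 2) by rewrite truncn_le sqrtr_ge0.
rewrite mulrDl mul1r div1r [_^-1 * _]mulrC -sqrtrV // -sqrtrM //.
by move: cnt; rewrite -(ler_nat R) natrD -natr1; lra.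
Qed.

Theorem theorem1p2 (R : realType) (h : nat -> int) (hh : h_identity h) :
  [/\ vinogradov_ll (fun X : R => Num.sqrt X / ln X)
                    (fun X : R => (count_h1 h X)%:R) /\
      (\forall X \near +oo%R,
         (count_h1 h X)%:R < (1 + 1 / Num.sqrt 2) * Num.sqrt X :> R),
      forall k : nat, (1 <= k)%N -> h (2 ^ k)%N = 1,
      forall p k : nat, prime p -> odd p -> (0 < k)%N ->
        h (p ^ (2 * k))%N = 1
    & forall p1 p2 : nat, prime p1 -> odd p1 -> prime p2 -> odd p2 ->
        Num.sqrt 2 * p1%:R < p2%:R :> R -> h (p1 ^ 2 * p2 ^ 2)%N = 1].
Proof.
split; first split.
- exists (ln 2 / 4); first by rewrite divr_gt0 // ln_gt0 //; lra.
  by near=> X; apply: count_lower => //; near: X; apply: nbhs_pinfty_ge; rewrite num_real.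
- by near=> X; apply: count_upper => //; near: X; apply: nbhs_pinfty_ge; rewrite num_real.
- by move=> k _; apply: h_pow2.
- by move=> p k pp op _; apply: h_prime_pow.
move=> p q pp op qp oq lt; apply: h_p2q2 => //.
have s0 : 0 <= Num.sqrt 2 * p%:R :> R by rewrite mulr_ge0 ?sqrtr_ge0.
rewrite -(ltr_nat R) natrM !natrX -[X in X * _ < _](@sqr_sqrtr R 2) // -exprMn.
by rewrite ltr_sqr ?nnegrE // ltW // (le_lt_trans s0).
Unshelve. all: by end_near.
Qed.
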